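(* Let $X$ be a non-discrete Fréchet–Urysohn Tychonoff space. If the hyperspace $\mathcal{S}_c(X)$ of nontrivial convergent sequences of $X$ is pseudocompact, then: $X$ has a dense subset that consists of isolated points of $X$ and is relatively countably compact in $X$; every finite power $X^n$ ($n\ge 1$) of $X$ is pseudocompact; and every $G_\delta$-point of $X$ (a point $x$ such that $\{x\}$ is a $G_\delta$-set in $X$) is isolated in $X$.
   Context: All spaces are Tychonoff (completely regular and Hausdorff). $X$ is Fréchet–Urysohn if whenever $x\in \overline{A}$, some sequence of points of $A$ converges to $x$. A subset $D\subseteq X$ is relatively countably compact in $X$ if every infinite subset of $D$ has an accumulation point in $X$. A Tychonoff space is pseudocompact if every continuous real-valued function on it is bounded. A nontrivial convergent sequence of $X$ is a subset $S\subseteq X$ such that $|S|=\omega$, $S$ (as a subspace) has a unique non-isolated point, denoted $x_S$, and $|S\setminus U|<\omega$ for each neighborhood $U$ of $x_S$. Let $\mathcal{CL}(X)$ be the set of all nonempty closed subsets of $X$, with the Vietoris topology: a base consists of the sets $\langle \mathcal{U}\rangle=\{F\in\mathcal{CL}(X): F\subseteq\bigcup\mathcal{U}\text{ and }F\cap U\neq\emptyset\text{ for all }U\in\mathcal{U}\}$, where $\mathcal{U}$ runs over nonempty finite families of nonempty open subsets of $X$. Let $\mathcal{S}_c(X)=\{S\in\mathcal{CL}(X): S\text{ is a nontrivial convergent sequence of }X\}$ with the subspace topology. *)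

(* Defs.v *)
From HB Require Import structures.
From mathcomp Require Import all_boot all_order all_algebra.
From mathcomp Require Import all_classical all_reals.
From mathcomp Require Import topology normedtype sequences borel_hierarchy.

Set Implicit Arguments.
Unset Strict Implicit.
Unset Printing Implicit Defensive.

Import Order.TTheory GRing.Theory Num.Theory.
Import numFieldNormedType.Exports.

Local Open Scope classical_set_scope.
Local Open Scope ring_scope.

Section point_set_topology.
Context (X : topologicalType).

(* [uniform_separatorP] unfolds [completely_regular_space] to the separation of
   points from closed sets by continuous functions into [0, 1]. *)
Definition tychonoff_space := completely_regular_space X /\ hausdorff_space X.

(* The axiom of the library structure [discreteNbhsType], as a proposition. *)
Definition discrete_space := (@nbhs X X) = principal_filter.

Definition frechet_urysohn_space := forall (A : set X) (x : X),
  closure A x -> exists2 u : nat -> X, (forall n, A (u n)) & u @ \oo --> x.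

Definition relatively_countably_compact (D : set X) := forall E : set X,
  E `<=` D -> infinite_set E -> limit_point E !=set0.

(* Complete regularity and separation are not part of the definition; [Sc X]
   and the finite powers of [X] inherit them from a Tychonoff [X].
   The choice of [R] is immaterial, all real types being isomorphic. *)
Definition pseudocompact (R : realType) :=
  forall f : X -> R, continuous f -> bounded_fun f.

Definition nontrivial_convergent_sequence (S : set X) :=
  (S #= [set: nat])%card /\
  exists x : X,
    [/\ S x /\ ~ isolated S x,
        forall y, S y -> ~ isolated S y -> y = x &
        forall U : set X, nbhs x U -> finite_set (S `\` U)].

End point_set_topology.

Section hyperspace.
Context (X : topologicalType).

Definition CL : Type := {F : set X | closed F /\ F !=set0}.

HB.instance Definition _ := gen_eqMixin CL.
HB.instance Definition _ := gen_choiceMixin CL.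

Definition vietoris_index : set (set (set X)) :=
  [set U | [/\ finite_set U, U !=set0 & forall A, U A -> open A /\ A !=set0]].

Definition vietoris_base (U : set (set X)) : set CL :=
  [set F | sval F `<=` \bigcup_(A in U) A /\
           forall A, U A -> sval F `&` A !=set0].

Let vietoris_cover : \bigcup_(U in vietoris_index) vietoris_base U = setT.
Proof.
apply/seteqP; split=> // -[F [cF [x Fx]]] _.
exists [set setT]; first split; first exact: finite_set1.
- by exists setT.
- by move=> A ->; split; [exact: openT|exists x].
split=> /=; first by move=> y _; exists setT.
by move=> A ->; exists x.
Qed.

Let vietoris_join (U V : set (set X)) (F : CL) :
  vietoris_index U -> vietoris_index V -> vietoris_base U F ->
  vietoris_base V F ->
  exists W, [/\ vietoris_index W, vietoris_base W F &
    vietoris_base W `<=` vietoris_base U `&` vietoris_base V].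
Proof.
move=> [finU [A0 UA0] oU] [finV [B0 VB0] oV] [FU FUA] [FV FVB].
have oUc : open (\bigcup_(A in U) A) by apply: bigcup_open => A /oU[].
have oVc : open (\bigcup_(B in V) B) by apply: bigcup_open => A /oV[].
pose W := [set A `&` \bigcup_(B in V) B | A in U] `|`
          [set B `&` \bigcup_(A in U) A | B in V].
have FW A : W A -> sval F `&` A !=set0.
  by case=> -[B + <-] => [/FUA|/FVB] [x [Fx Bx]];
    exists x; do 2?split => //; [exact: FV|exact: FU].
exists W; split.
- split.
  + by rewrite finite_setU; split; exact: finite_image.
  + by exists (A0 `&` \bigcup_(B in V) B); left; exists A0.
  + move=> A WA; split; last by have [x [_ ?]] := FW _ WA; exists x.
    by case: WA => -[B + <-] => [/oU|/oV] [oB _]; exact: openI.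
- split=> // x Fx; have [A UA Ax] := FU _ Fx.
  by exists (A `&` \bigcup_(B in V) B); [left; exists A|split=> //; exact: FV].
- move=> G [GW GWA]; split; split.
  + move=> x /GW[_ [|] [A ? <-]] [] //.
    by move=> Ax _; exists A.
  + move=> A UA; have [|x [Gx [Ax _]]] := GWA (A `&` \bigcup_(B in V) B).
      by left; exists A.
    by exists x.
  + move=> x /GW[_ [|] [A ? <-]] [] //.
    by move=> Ax _; exists A.
  + move=> A VA; have [|x [Gx [Ax _]]] := GWA (A `&` \bigcup_(B in U) B).
      by right; exists A.
    by exists x.
Qed.

HB.instance Definition _ :=
  isBaseTopological.Build CL vietoris_cover vietoris_join.

(* As a type, [Sc] carries the subspace topology induced by [CL]: this is the
   library's topology on [set_type]. *)
Definition Sc : set CL := [set F | nontrivial_convergent_sequence (sval F)].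

End hyperspace.

Arguments Sc X : clear implicits.

(* Main.v *)
Require Import Defs.
From mathcomp Require Import all_boot all_order all_algebra.
From mathcomp Require Import all_classical all_reals.
From mathcomp Require Import topology normedtype sequences borel_hierarchy.
From mathcomp Require Import numfun.

Local Open Scope classical_set_scope.

(** The hypothesis is much stronger than it looks: [X] must be the one-point
    compactification of an infinite discrete set.

    Pseudocompactness is used in one form only ([pseudocompact_common_closure]):
    if continuous functions [h n >= 0] are such that any finitely many of them
    take the value 1 at a common point, then some point lies in the closure of
    [h n != 0] for every [n].

    Given open sets [V n != set0] of [X], take [h n F] to be the supremum over
    [F] of a continuous function supported in [V n] and equal to 1 at some
    point of [V n].  Adding finitely many points to a nontrivial convergent
    sequence yields another one, so the [h n] meet the requirement, and a
    single nontrivial convergent sequence [S] meets the closures of all the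
    [V n] ([Sc_meets_closures]).

    If infinitely many [V n] with disjoint closures lie in a closed set [A],
    then [S] has infinitely many points in [A], hence its limit lies in [A].
    So this cannot happen simultaneously in two disjoint closed sets [A] and
    [B] ([Sc_no_two_clusters]).  Every neighborhood of a non-isolated point
    contains infinitely many such [V n], whence there is only one non-isolated
    point [x] ([unique_nonisolated]).  Every set that avoids [x] is then open,
    and an infinite set in the complement of an open neighborhood [O] of [x]
    would give the forbidden configuration with [A = O] and [B = ~` O].
    Hence all neighborhoods of [x] are cofinite
    ([cofinite_nbhs_nonisolated]).

    The conclusions follow.  The isolated points are the points of [~` [set x]],
    a dense set of which every infinite subset accumulates at [x]; [X] is
    compact, and so are its powers; and if [[set x]] were the intersection of
    open sets [U n], the clopen sets of those [F] that are included in [U n]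
    would have the finite intersection property, but a common element would be
    reduced to [x] ([Gdelta_isolated]). *)

Set Implicit Arguments.
Unset Strict Implicit.
Unset Printing Implicit Defensive.

Import Order.TTheory GRing.Theory Num.Theory.
Import numFieldNormedType.Exports.

(** * Pseudocompact spaces *)

Section pseudocompact_spaces.
Context {R : realType}.
Local Open Scope ring_scope.

Lemma bounded_funP (T : Type) (f : T -> R) :
  bounded_fun f <-> exists M, forall x, `|f x| <= M.
Proof.
split=> [/pinfty_ex_gt0[M _ fM]|[M fM]]; first by exists M => x; exact: fM.
by exists M; split=> [|N MN x _ /=]; rewrite ?num_real// (le_trans (fM x)) ?ltW.
Qed.

Lemma compact_pseudocompact (Y : topologicalType) :
  compact [set: Y] -> pseudocompact Y R.
Proof.
move=> cY f cf; apply/bounded_funP.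
have /compact_bounded/pinfty_ex_gt0[M _ fM] : compact (f @` setT).
  by apply: continuous_compact => //; exact: continuous_subspaceT.
by exists M => x; apply: fM; exists x.
Qed.

(** Otherwise the functions [g n = h 0 * ... * h n] have locally finite
    supports, and their sum is continuous and unbounded: it is at least [N]
    wherever [h 0], ..., [h N.-1] all equal 1. *)
Lemma pseudocompact_common_closure (Y : topologicalType) (h : nat -> Y -> R) :
  pseudocompact Y R -> (forall n, continuous (h n)) ->
  (forall n y, 0 <= h n y) ->
  (forall N, exists y, forall n, (n < N)%N -> h n y = 1) ->
  exists y, forall n, closure [set z | h n z != 0] y.
Proof.
move=> pcY hc h0 h1; apply: contrapT => nY.
have ev (y : Y) : exists n, \forall z \near y, h n z = 0.
  apply: contrapT => ny; apply: nY; exists y => n A yA; apply: contrapT => nA.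
  apply: ny; exists n; apply: filterS yA => z Az; apply: contrapT => /eqP hz.
  by apply: nA; exists z.
have {nY}/choice[N hN] (y : Y) : exists n, h n y = 0.
  by have [n /nbhs_singleton] := ev y; exists n.
pose g n y := \prod_(i < n.+1) h i y.
have gc n : continuous (g n).
  move=> y; rewrite /continuous_at /g.
  apply: (@cvg_big R 'I_n.+1 *%R 1 xpredT mul_continuous Y (nbhs y) _
    (fun i : 'I_n.+1 => h i) (fun i => h i y)) => i _.
  exact: hc.
have g0 n y k : (k <= n)%N -> h k y = 0 -> g n y = 0.
  move=> kn hk; rewrite /g (bigD1 (inord k)) //= inordK ?ltnS//.
  by rewrite hk mul0r.
have g_ge0 n y : 0 <= g n y by apply: prodr_ge0.
have sumE k n y : h k y = 0 -> (k <= n)%N ->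
    \sum_(i < n) g i y = \sum_(i < k) g i y.
  move=> hk kn; rewrite -(subnKC kn) big_split_ord /= [X in _ + X]big1 ?addr0//.
  by move=> i _; apply: g0 hk; rewrite leq_addr.
(* The sum of all the [g n] at [y]: the terms from [N y] on vanish. *)
pose f y := \sum_(i < N y) g i y.
have fE k y : h k y = 0 -> f y = \sum_(i < k) g i y.
  move=> hk; rewrite -(sumE k _ y hk (leq_maxl k (N y))).
  by rewrite (sumE _ _ y (hN y) (leq_maxr k (N y))).
have fc : continuous f.
  move=> y; have [k hk] := ev y; rewrite /continuous_at.
  rewrite (fE _ _ (nbhs_singleton hk)).
  apply: cvg_trans (@cvg_big R 'I_k +%R 0 xpredT add_continuous Y (nbhs y)
    _ (fun i : 'I_k => g i) (fun i => g i y) _ _); last first.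
    by move=> i _; exact: gc.
  apply: near_eq_cvg; apply: filterS hk => z hz.
  by rewrite (fE _ _ hz).
have /bounded_funP[M fM] := pcY f fc.
have [y hy] := h1 (Num.truncn M).+1.
have NM : ((Num.truncn M).+1 <= N y)%N.
  rewrite leqNgt; apply/negP => /hy; rewrite hN => /esym/eqP.
  by rewrite oner_eq0.
have := fM y; rewrite leNgt => /negP; apply; apply: lt_le_trans (ler_norm _).
apply: lt_le_trans (truncnS_gt M) _.
rewrite /f -(subnKC NM) big_split_ord /= -[leLHS]addr0 lerD ?sumr_ge0//.
rewrite -[X in X%:R]card_ord -sumr_const; apply: ler_sum => i _.
by rewrite /g big1// => j _; apply: hy; rewrite (leq_trans (ltn_ord j)).
Qed.

Lemma indic_clopen_continuous (Y : topologicalType) (A : set Y) :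
  open A -> open (~` A) -> continuous (\1_A : Y -> R).
Proof.
move=> oA oAC z; apply: (@cvg_near_cst _ _ _ _ (nbhs z)).
have [Az|nAz] := pselect (A z).
  apply: filterS (open_nbhs_nbhs (conj oA Az)) => w Aw.
  by rewrite !indicE !mem_set.
apply: filterS (open_nbhs_nbhs (conj oAC nAz)) => w Aw.
by rewrite !indicE !memNset.
Qed.

End pseudocompact_spaces.

(** * Vietoris topology *)

Section vietoris.
Context {R : realType} {X : topologicalType}.
Local Open Scope ring_scope.

Lemma CL_nonempty (F : CL X) : sval F !=set0.
Proof. by case: F => F []. Qed.

Lemma open_vietoris_base (U : set (set X)) :
  vietoris_index U -> open (vietoris_base U).
Proof.
by move=> iU; exists [set U]; [move=> _ ->|rewrite bigcup_set1].
Qed.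

Lemma open_included (O : set X) :
  open O -> open [set F : CL X | sval F `<=` O].
Proof.
move=> oO; have [->|O0] := eqVneq O set0.
  rewrite (_ : [set _ | _] = set0); first exact: open0.
  by apply/seteqP; split=> // -[F [cF [x Fx]]] /= /(_ x Fx).
rewrite (_ : [set _ | _] = vietoris_base [set O]).
  apply: open_vietoris_base; split; first exact: finite_set1.
    by exists O.
  by move=> _ ->; split=> //; exact/set0P.
apply/seteqP; split=> [[F [cF [x Fx]]] /= FO|F [FO _] x /FO[_ ->//]].
split=> [y /FO Oy|_ -> /=]; first by exists O.
by exists x; split => //; exact: FO.
Qed.

Lemma open_meets (O : set X) :
  open O -> open [set F : CL X | sval F `&` O !=set0].
Proof.
move=> oO; have [->|O0] := eqVneq O set0.
  rewrite (_ : [set _ | _] = set0); first exact: open0.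
  by apply/seteqP; split=> // -[F cF] /= -[x []].
rewrite (_ : [set _ | _] = vietoris_base [set O; setT]).
  apply: open_vietoris_base; split; first exact: finite_set2.
    by exists O; left.
  move/set0P : O0 => [x Ox].
  by move=> _ [->|->]; split => //; [exists x|exact: openT|exists x].
apply/seteqP; split=> [[F [cF [x Fx]]] /= FO|F [_]]; last by apply; left.
split=> [y Fy|_ [->//|->] /=]; first by exists setT => //; right.
by exists x.
Qed.

Definition sup_over (phi : X -> R) (F : CL X) : R := sup (phi @` sval F).

Lemma le_sup_over (phi : X -> R) (F : CL X) z :
  has_ubound (range phi) -> sval F z -> phi z <= sup_over phi F.
Proof.
move=> [M phiM] Fz; apply: ub_le_sup; last by exists z.
by exists M => _ [y _ <-]; apply: phiM; exists y.
Qed.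

(** Sets meeting [phi @^-1` `]a, +oo[] bound the supremum from below, and sets
    included in [phi @^-1` `]-oo, b[] bound it from above; both are Vietoris
    open conditions. *)
Lemma sup_over_continuous (phi : X -> R) :
  continuous phi -> has_ubound (range phi) -> continuous (sup_over phi).
Proof.
move=> cphi ubphi F; have [M phiM] := ubphi.
have hs (G : CL X) : has_sup (phi @` sval G).
  case: G => G [cG [x Gx]]; split; first by exists (phi x), x.
  by exists M => _ [y _ <-]; apply: phiM; exists y.
apply/(@cvgrPdist_le _ _ _ _ (nbhs_filter F)) => e e0.
have oU : open [set x | phi x < sup_over phi F + e].
  exact: (open_comp (fun x _ => cphi x) (@open_lt R _)).
have oL : open [set x | sup_over phi F - e < phi x].
  exact: (open_comp (fun x _ => cphi x) (@open_gt R _)).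
have FU : sval F `<=` [set x | phi x < sup_over phi F + e].
  by move=> x /(le_sup_over ubphi) xF /=; rewrite (le_lt_trans xF)// ltrDl.
have FL : sval F `&` [set x | sup_over phi F - e < phi x] !=set0.
  by have [_ [x Fx <-] ?] := sup_adherent e0 (hs F); exists x.
have nU := open_nbhs_nbhs (conj (open_included oU) FU).
have nL := open_nbhs_nbhs (conj (open_meets oL) FL).
near=> G.
have GU : sval G `<=` [set x | phi x < sup_over phi F + e] by near: G.
have [x [Gx Lx]] : sval G `&` [set x | sup_over phi F - e < phi x] !=set0.
  by near: G.
rewrite ler_distlC; apply/andP; split.
  exact: le_trans (ltW Lx) (le_sup_over ubphi Gx).
by apply: ge_sup => [|_ [y /GU/ltW ? <-]//]; exists (phi x), x.
Unshelve. all: by end_near. Qed.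

End vietoris.

(** * Nontrivial convergent sequences in Hausdorff spaces *)

Section infinite_sets.
Context {T : choiceType}.

Lemma infinite_set_inj (A : set T) :
  infinite_set A -> exists e : nat -> T, injective e /\ forall n, A (e n).
Proof.
elim/choicePpointed: T => T' in A *; first by rewrite emptyE.
move=> /infiniteP/ppcard_leP[f]; exists f; split.
  by move=> m n fmn; apply: (@inj _ _ _ f); rewrite ?inE.
by move=> n; have /(_ n I) := @funS _ _ _ _ f.
Qed.

Lemma infinite_inj_range (A : set T) (e : nat -> T) :
  injective e -> (forall n, A (e n)) -> infinite_set A.
Proof.
move=> ie eA fA; apply: infinite_nat.
rewrite (_ : setT = e @^-1` A); last by apply/seteqP; split=> // n _; exact: eA.
by apply: finite_preimage => // m n _ _ /ie.
Qed.

Lemma infinite_meets_trivIset (A : set T) (C : nat -> set T) :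
  trivIset setT C -> (forall n, A `&` C n !=set0) -> infinite_set A.
Proof.
move=> tC /choice[e /all_and2[eA eC]].
apply: (@infinite_inj_range _ e) => // m n emn.
by apply: tC => //; exists (e m); split => //; rewrite emn.
Qed.

Lemma countable_setU (A B : set T) :
  countable A -> countable B -> countable (A `|` B).
Proof.
by move=> cA cB; rewrite -bigcup2E; apply: bigcup_countable => // -[|[|n]].
Qed.

End infinite_sets.

Section convergent_sets.
Context {X : topologicalType}.
Context (hX : hausdorff_space X).
Implicit Types (S U : set X) (x : X).

Lemma hausdorff_disjoint_open x y : x <> y ->
  exists A B : set X, [/\ open A, open B, A x, B y & A `&` B = set0].
Proof.
move=> /eqP xy; have := hX; rewrite open_hausdorff => /(_ _ _ xy).
by case=> -[A B] /= [/set_mem Ax /set_mem By] [oA oB /eqP]; exists A, B.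
Qed.

Lemma hausdorff_finite_closed (A : set X) : finite_set A -> closed A.
Proof. exact: accessible_finite_set_closed.1 (hausdorff_accessible hX) A. Qed.

Lemma isolated_setTP x : isolated [set: X] x <-> open [set x].
Proof.
split=> [[_ [V xV]]|ox].
  by rewrite setIT => Vx; rewrite Vx in xV; rewrite openE => _ ->.
split; rewrite ?inE//; exists [set x]; rewrite ?setIT//.
exact: open_nbhs_nbhs.
Qed.

(** In a Hausdorff space these are exactly the nontrivial convergent sequences
    with limit [x]: that [S] is closed and that its points other than [x] are
    isolated in [S] follows.  This form is visibly stable under finite changes
    of [S]. *)
Definition converges_to S x :=
  [/\ S x, countable S, infinite_set S &
    forall U, nbhs x U -> finite_set (S `\` U)].

(** Disjoint neighborhoods of [x] and [y] leave only finitely many points of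
    [S] near [y], and finite sets are closed. *)
Lemma converges_to_off S x y : converges_to S x -> y <> x ->
  exists2 V, nbhs y V & V `&` S `<=` [set y].
Proof.
move=> [_ _ _ cS] yx.
have [A [B [oA oB Ax By AB]]] := hausdorff_disjoint_open (not_eq_sym yx).
have fSA : finite_set ((S `\` A) `\ y).
  by apply: finite_setD; apply: cS; exact: open_nbhs_nbhs.
exists (B `&` ~` ((S `\` A) `\ y)); last first.
  move=> z [[Bz nz] Sz]; apply: contrapT => zy; apply: nz.
  split=> //; split=> // Az.
  by suff : set0 z by []; rewrite -AB.
apply: open_nbhs_nbhs; split; last by split => // -[_]; apply.
by apply: openI => //; rewrite openC; exact: hausdorff_finite_closed fSA.
Qed.

Lemma converges_to_closed S x : converges_to S x -> closed S.
Proof.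
move=> aS y Sy; have [->|/eqP yx] := eqVneq y x; first by case: aS.
have [V yV VS] := converges_to_off aS yx.
by have [z [Sz Vz]] := Sy _ yV; rewrite -(VS z).
Qed.

Lemma converges_to_Sc S x :
  converges_to S x -> nontrivial_convergent_sequence S.
Proof.
move=> aS; have [Sx cS iS fS] := aS; split; first exact: eq_card_nat.
exists x; split => //.
  split=> // -[_ [V xV VS]]; apply: iS.
  rewrite -(setUIDK S V) finite_setU setIC VS.
  by split; [exact: finite_set1|exact: fS].
move=> y Sy ny; apply: contrapT => yx; apply: ny.
have [V yV VS] := converges_to_off aS yx.
split; first by rewrite inE.
exists V => //; apply/seteqP; split => // _ ->; split => //.
exact: nbhs_singleton.
Qed.

Lemma Sc_converges_to S : nontrivial_convergent_sequence S ->
  exists x, converges_to S x.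
Proof.
move=> [cS [x [[Sx _] _ fS]]]; exists x; split=> //.
  by rewrite (eq_countable cS).
move=> fin; apply: infinite_nat.
by rewrite -(eq_finite_set cS).
Qed.

Lemma converges_to_finite_diff S S' x : converges_to S x -> S' x ->
  infinite_set S' -> finite_set (S' `\` S) -> converges_to S' x.
Proof.
move=> [Sx cS iS fS] S'x iS' fS'.
have S'E U : S' `\` U `<=` (S' `\` S) `|` (S `\` U).
  by move=> y [S'y Uy]; have [Sy|Sy] := pselect (S y); [right|left].
split=> //; last first.
  by move=> U /fS fSU; apply: sub_finite_set (S'E U) _; rewrite finite_setU.
apply: sub_countable (subset_card_le (_ : _ `<=` (S' `\` S) `|` S)) _.
  by move=> y S'y; have [Sy|Sy] := pselect (S y); [right|left].
by apply: countable_setU => //; exact: finite_set_countable.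
Qed.

(** A sequence of points other than [x] that converges to [x] has an infinite
    range, a finite range being closed. *)
Lemma frechet_urysohn_converges_to x : frechet_urysohn_space X ->
  ~ isolated [set: X] x -> exists S, converges_to S x.
Proof.
move=> fu nx.
have [|u ux xu] := fu (~` [set x]) x.
  move=> V xV; apply: contrapT => Vx; apply: nx; split; rewrite ?inE//.
  exists V => //; rewrite setIT; apply/seteqP; split=> [y Vy|_ ->].
    by apply: contrapT => yx; apply: Vx; exists y.
  exact: nbhs_singleton.
exists (range u `|` [set x]); split; first by right.
- by apply: countable_setU; [exact: card_image_le|exact: countable1].
- move=> fu'; have fr : finite_set (range u) by apply: sub_finite_set fu'; left.
  have /xu : nbhs x (~` range u).
    apply: open_nbhs_nbhs; split; last by move=> [n _ /ux].
    by rewrite openC; exact: hausdorff_finite_closed.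
  by move=> [N _ /(_ N (leqnn N))]; apply; exists N.
- move=> U xU; have [N _ uU] := xu _ xU.
  apply: (@sub_finite_set _ _ (u @` `I_N)); last exact: finite_image.
  move=> y [[[n _ <-]|->] nU]; last by have := nbhs_singleton xU.
  by exists n => //=; rewrite ltnNge; apply/negP => /uU.
Qed.

End convergent_sets.

(** * Consequences of the pseudocompactness of [Sc X] *)

Section pseudocompact_Sc.
Context {R : realType} {X : topologicalType}.
Local Open Scope ring_scope.
Context (tX : tychonoff_space X).
Context (fuX : frechet_urysohn_space X).
Context (pcS : pseudocompact (set_type (Sc X)) R).

Let hX : hausdorff_space X := tX.2.

Let regX : regular_space X := completely_regular_regular (R := R) tX.1.

Lemma regular_open (A : set X) x : open A -> A x ->
  exists V, [/\ open V, V x & closure V `<=` A].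
Proof.
move=> oA Ax; have [|V xV VA] := @regX x A; first exact: open_nbhs_nbhs.
exists V°; split; [exact: open_interior|exact: xV|].
exact: subset_trans (closure_subset (@interior_subset _ _)) VA.
Qed.

Definition Sc_of S x (aS : converges_to S x) : set_type (Sc X) :=
  SigSub (mem_set (converges_to_Sc hX aS : Sc X
    (exist _ S (conj (converges_to_closed hX aS)
                (ex_intro _ x (let: And4 Sx _ _ _ := aS in Sx)))))).

(** The functions [sup_over (phi n)] satisfy the hypotheses of
    [pseudocompact_common_closure]; if [S] missed the closure of the support of
    [phi n], then so would all closed sets close to [S], and [sup_over (phi n)]
    would vanish around [S]. *)
Lemma Sc_common_support (phi : nat -> X -> R) :
  (forall n, continuous (phi n)) ->
  (forall n, range (phi n) `<=` `[0, 1]) ->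
  (forall N, exists S x, converges_to S x /\
     forall n, (n < N)%N -> exists2 y, S y & phi n y = 1) ->
  exists S y, converges_to S y /\
    forall n, S `&` closure [set z | phi n z != 0] !=set0.
Proof.
move=> cphi phi01 Sphi.
have /all_and2[phi_ge0 phi_le1] n : (forall z, 0 <= phi n z) /\
    forall z, phi n z <= 1.
  apply/all_and2 => z; have /= := phi01 n (phi n z) (imageT (phi n) z).
  by rewrite in_itv/= => /andP.
have ubphi n : has_ubound (range (phi n)) by exists 1 => _ [z _ <-].
pose h n (y : set_type (Sc X)) := sup_over (phi n) (set_val y).
have [|||F hF] := @pseudocompact_common_closure R _ h pcS.
- move=> n y; apply: continuous_comp; first exact: initial_continuous.
  exact: sup_over_continuous.
- move=> n y; rewrite /h; have [z Fz] := CL_nonempty (set_val y).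
  exact: le_trans (phi_ge0 n z) (le_sup_over (ubphi n) Fz).
- move=> N; have [S [x [aS Sphi1]]] := Sphi N.
  exists (Sc_of aS) => n /Sphi1[y Sy phiy].
  apply/eqP; rewrite eq_le; apply/andP; split.
    by apply: ge_sup => [|_ [z _ <-]//]; exists (phi n y), y.
  by rewrite -phiy; exact: le_sup_over.
have [y aF] := Sc_converges_to (set_mem (valP F)).
exists (sval (set_val F)), y; split => // n; apply: contrapT => Fn.
have oC : open (~` closure [set z | phi n z != 0]).
  by rewrite openC; exact: closed_closure.
have Fsub : sval (set_val F) `<=` ~` closure [set z | phi n z != 0].
  by move=> z Fz cz; apply: Fn; exists z.
have nF : nbhs (set_val F)
    [set G : CL X | sval G `<=` ~` closure [set z | phi n z != 0]].
  by apply: open_nbhs_nbhs; split => //; exact: open_included.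
have [G [/eqP hG GC]] := hF n _ (initial_continuous nF).
apply: hG; rewrite /h /sup_over (_ : _ @` _ = [set 0]) ?sup1//.
have G0 z : sval (set_val G) z -> phi n z = 0.
  move=> /GC nz; apply: contrapT => /eqP phiz; apply: nz.
  exact: subset_closure.
apply/seteqP; split=> [_ [z /G0 phiz <-]//|_ ->].
by have [z Gz] := CL_nonempty (set_val G); exists z => //; exact: G0.
Qed.

(** A nontrivial convergent sequence remains one when finitely many points are
    added, so some member of [Sc X] meets any finitely many of the [V n];
    pseudocompactness passes to all of them at the price of closures. *)
Lemma Sc_meets_closures x (V : nat -> set X) : ~ isolated [set: X] x ->
  (forall n, open (V n)) -> (forall n, V n !=set0) ->
  exists S y, converges_to S y /\ forall n, S `&` closure (V n) !=set0.
Proof.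
move=> nx oV /choice[p Vp].
have /choice[phi phiP] n : exists f : X -> R,
    [/\ continuous f, range f `<=` `[0, 1], f (p n) = 1 &
        forall z, ~ V n z -> f z = 0].
  have cV : closed (~` V n) by rewrite closedC.
  have nVp : ~ (~` V n) (p n) by move=> /(_ (Vp n)).
  have /(uniform_separatorP (R := R))[f [cf f01 f0 f1]] := tX.1 (p n) _ cV nVp.
  exists (fun z => 1 - f z); split.
  - by move=> z; apply: cvgB; [exact: cvg_cst|exact: cf].
  - move=> _ [z _ <-]; have /= := f01 (f z) (ex_intro2 _ _ z I erefl).
    by rewrite !in_itv/= subr_ge0 gerBl => /andP[-> ->].
  - by rewrite (f0 (f (p n))) ?subr0//; exists (p n).
  - by move=> z Vz; rewrite (f1 (f z)) ?subrr//; exists z.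
have [|||S [y [aS Sphi]]] := @Sc_common_support phi.
- by move=> n; case: (phiP n).
- by move=> n; case: (phiP n).
- move=> N; have [S0 aS0] := frechet_urysohn_converges_to hX fuX nx.
  exists (S0 `|` [set p n | n in `I_N]), x; split; last first.
    by move=> n nN; exists (p n); [right; exists n|case: (phiP n)].
  have [Sx _ iS _] := aS0; apply: converges_to_finite_diff aS0 _ _ _.
  + by left.
  + by apply: sub_infinite_set iS; left.
  + apply: (@sub_finite_set _ _ [set p n | n in `I_N]).
      by move=> z [[]].
    exact: finite_image.
exists S, y; split => // n; have [z [Sz Cz]] := Sphi n.
exists z; split=> //; apply: closure_subset Cz => w /= /eqP phiw.
by apply: contrapT => /(let: And4 _ _ _ P := phiP n in P w).
Qed.

(** A convergent sequence that meets all the disjoint sets [closure (V n)] has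
    infinitely many points in [A], so its limit is in [A]; for the same reason
    its limit is in [B]. *)
Lemma Sc_no_two_clusters x (A B : set X) (V W : nat -> set X) :
  ~ isolated [set: X] x -> closed A -> closed B -> A `&` B = set0 ->
  (forall n, [/\ open (V n), V n !=set0 & closure (V n) `<=` A]) ->
  (forall n, [/\ open (W n), W n !=set0 & closure (W n) `<=` B]) ->
  trivIset setT (closure \o V) -> trivIset setT (closure \o W) -> False.
Proof.
move=> nx cA cB AB hV hW tV tW.
(* Interleaving gives a single sequence that meets both families. *)
have [||S [y [aS SVW]]] :=
  @Sc_meets_closures x (fun n => if odd n then V n./2 else W n./2) nx.
- by move=> n; case: ifP => _; [case: (hV n./2)|case: (hW n./2)].
- by move=> n; case: ifP => _; [case: (hV n./2)|case: (hW n./2)].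
have SV n : S `&` closure (V n) !=set0.
  by have := SVW n.*2.+1; rewrite /= odd_double uphalf_double.
have SW n : S `&` closure (W n) !=set0.
  by have := SVW n.*2; rewrite odd_double doubleK.
have [_ _ _ fS] := aS.
have avoid (C : set X) (U : nat -> set X) : closed C -> ~ C y ->
    trivIset setT (closure \o U) -> (forall n, closure (U n) `<=` C) ->
    (forall n, S `&` closure (U n) !=set0) -> False.
  move=> cC Cy tU UC SU.
  have : finite_set (S `\` ~` C).
    by apply/fS/open_nbhs_nbhs; split => //; rewrite openC.
  apply: infinite_meets_trivIset tU _ => n.
  have [z [Sz Uz]] := SU n; exists z; split => //; split => // nz.
  exact/nz/(UC n).
have [Ay|nAy] := pselect (A y).
  apply: (avoid B W) => // [By|n]; last by case: (hW n).
  by suff : set0 y by []; rewrite -AB.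
by apply: (avoid A V) => // n; case: (hV n).
Qed.

(** Take points [e n] of a sequence that converges to [x] inside [A].  Each has
    a neighborhood [O n] whose closure contains no other [e m], and the
    neighborhoods are made disjoint by removing from [O n] the closures of the
    previous ones. *)
Lemma open_trivIset_closure_near x (A : set X) :
  ~ isolated [set: X] x -> open A -> A x ->
  exists V : nat -> set X,
    (forall n, [/\ open (V n), V n !=set0 & closure (V n) `<=` A]) /\
    trivIset setT (closure \o V).
Proof.
move=> nx oA Ax; have [S aS] := frechet_urysohn_converges_to hX fuX nx.
have [Sx _ iS fS] := aS.
have iSA : infinite_set ((S `&` A) `\ x).
  apply: infinite_setD => // fSA; apply: iS; rewrite -(setUIDK S A) finite_setU.
  by split => //; apply/fS/open_nbhs_nbhs.
have [e [ie eP]] := infinite_set_inj iSA.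
have /choice[O hO] n : exists U,
    [/\ open U, U (e n) & closure U `<=` A `&` ~` (S `\ e n)].
  have [[Sen Aen] xen] := eP n.
  apply: regular_open; last by split => // -[_]; apply.
  apply: openI => //; rewrite openC; apply: (@converges_to_closed _ hX _ x).
  apply: converges_to_finite_diff aS _ _ _.
  - by split => // xe; apply: xen; rewrite xe.
  - exact: infinite_setD.
  - by apply: (@sub_finite_set _ _ set0) => // z [[]].
have /choice[V hV] n : exists U, [/\ open U, U (e n) &
    closure U `<=` O n `&` ~` (\bigcup_(m in `I_n) closure (O m))].
  apply: regular_open.
    apply: openI; first by case: (hO n).
    by rewrite openC; apply: closed_bigcup => // m _; exact: closed_closure.
  split; first by case: (hO n).
  move=> [m /= mn]; case: (hO m) => _ _ OA /OA[_]; apply; split.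
    by case: (eP n) => -[].
  by move=> /ie nm; rewrite nm ltnn in mn.
exists V; split=> [n|].
  have [oV Ve VO] := hV n; split => //; first by exists (e n).
  have [_ _ OA] := hO n.
  by move=> z /VO[Oz _]; have [] := OA z (subset_closure Oz).
suff disj m n : (m < n)%N -> closure (V m) `&` closure (V n) = set0.
  apply/trivIsetP => m n _ _; rewrite neq_ltn => /orP[]/disj //=.
  by rewrite setIC.
move=> mn; apply/seteqP; split=> // z [].
case: (hV m) => _ _ VO /VO[Omz _]; case: (hV n) => _ _ {}VO /VO[_]; apply.
by exists m => //; exact: subset_closure.
Qed.

(** Two such points would have disjoint closed neighborhoods, each containing a
    sequence of open sets with disjoint closures. *)
Lemma unique_nonisolated x y :
  ~ isolated [set: X] x -> ~ isolated [set: X] y -> x = y.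
Proof.
move=> nx ny; apply: contrapT => xy.
have [A [B [oA oB Ax By AB]]] := hausdorff_disjoint_open hX xy.
have [A' [oA' A'x A'A]] := regular_open oA Ax.
have [B' [oB' B'y B'B]] := regular_open oB By.
have [V [hV tV]] := open_trivIset_closure_near nx oA' A'x.
have [W [hW tW]] := open_trivIset_closure_near ny oB' B'y.
apply: (@Sc_no_two_clusters x (closure A') (closure B') V W) => //.
- exact: closed_closure.
- exact: closed_closure.
- by apply/seteqP; split => // z [/A'A Az /B'B Bz]; rewrite -AB.
- move=> n; have [? ? VA] := hV n; split => //.
  exact: subset_trans VA (@subset_closure _ _).
- move=> n; have [? ? WB] := hW n; split => //.
  exact: subset_trans WB (@subset_closure _ _).
Qed.

Lemma open_off_nonisolated x (A : set X) :
  ~ isolated [set: X] x -> ~ A x -> open A.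
Proof.
move=> nx nA; rewrite openE => z Az.
have /isolated_setTP oz : isolated [set: X] z.
  by apply: contrapT => nz; apply: nA; rewrite (unique_nonisolated nx nz).
by apply: (filterS (P := [set z])) (open_nbhs_nbhs _) => // _ ->.
Qed.

(** An infinite set of isolated points off a neighborhood [O] of [x], taken as
    open singletons, forms a second cluster beside the one near [x]; [O] is
    clopen because its complement avoids [x]. *)
Lemma cofinite_nbhs_nonisolated x (U : set X) :
  ~ isolated [set: X] x -> nbhs x U -> finite_set (~` U).
Proof.
move=> nx; rewrite nbhsE => -[O [oO Ox] OU].
apply: (@sub_finite_set _ _ (~` O)); first exact: subsetC.
apply: contrapT => iO.
have [V [hV tV]] := open_trivIset_closure_near nx oO Ox.
have [e [ie Oe]] := infinite_set_inj iO.
have ce n : closure [set e n] = [set e n].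
  by apply/esym/closure_id; exact: hausdorff_finite_closed.
apply: (@Sc_no_two_clusters x O (~` O) V (fun n => [set e n])) => //.
- by rewrite -openC; apply: (open_off_nonisolated nx) => /(_ Ox).
- by rewrite closedC.
- exact: setICr.
- move=> n; split; last by rewrite ce => _ ->.
    by apply: (open_off_nonisolated nx) => xe; apply: (Oe n); rewrite -xe.
  by exists (e n).
- by move=> m n _ _ [z []] /=; rewrite !ce => -> /ie.
Qed.

Lemma compact_setT x : ~ isolated [set: X] x -> compact [set: X].
Proof.
move=> nx F PF _.
have [cFx|ncFx] := pselect (cluster F x); first by exists x.
have [U [xU FU]] : exists U, nbhs x U /\ F (~` U).
  apply: contrapT => nU; apply: ncFx => A U FA xU; apply: contrapT => AU.
  apply: nU; exists U; split => //; apply: filterS FA => z Az Uz.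
  by apply: AU; exists z.
have [//|z [_ cz]] := finite_compact (cofinite_nbhs_nonisolated nx xU) PF.
by exists z.
Qed.

Lemma relatively_countably_compact_setC1 x :
  ~ isolated [set: X] x -> relatively_countably_compact (~` [set x]).
Proof.
move=> nx E Ex iE; exists x => U /(cofinite_nbhs_nonisolated nx) fU.
have [z [Ez Uz]] : E `&` U !=set0.
  apply: infinite_setN0 => fEU; apply: iE; rewrite -(setUIDK E U) finite_setU.
  by split => //; apply: sub_finite_set fU => z [].
by exists z; split => //; apply/eqP/Ex.
Qed.

Lemma dense_setC1 x : ~ isolated [set: X] x -> dense (~` [set x]).
Proof.
move=> nx O [z Oz] oO; apply: contrapT => OC; apply: nx.
apply/isolated_setTP; rewrite (_ : [set x] = O)//.
have Ox w : O w -> w = x.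
  by move=> Ow; apply: contrapT => wx; apply: OC; exists w.
by apply/seteqP; split=> [_ ->|w /Ox//]; rewrite -(Ox z).
Qed.

(** The sets of those [F] included in [U n] are clopen and have the finite
    intersection property: cut a sequence that converges to [x] by finitely many
    of the [U n].  A common element would be included in [[set x]], but it is
    infinite. *)
Lemma Gdelta_isolated x : Gdelta [set x] -> isolated [set: X] x.
Proof.
move=> [U oU Ux]; apply: contrapT => nx.
have Unx n : U n x by have : [set x] x by []; rewrite Ux; apply.
have oUC n : open (~` U n) by apply: (open_off_nonisolated nx) => /(_ (Unx n)).
pose inU n := [set y : set_type (Sc X) | sval (set_val y) `<=` U n].
pose outU n := [set G : CL X | sval G `&` ~` U n !=set0].
have inUC n : ~` inU n = set_val @^-1` outU n.
  apply/seteqP; split=> [y /= nyU|y [z [yz nUz]] yU]; last exact/nUz/yU.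
  apply: contrapT => ny; apply: nyU => z yz; apply: contrapT => nUz.
  by apply: ny; exists z.
have [|||F hF] := @pseudocompact_common_closure R _ (fun n => \1_(inU n)) pcS.
- move=> n; apply: indic_clopen_continuous.
    by exists [set G : CL X | sval G `<=` U n]; first exact: open_included.
  by rewrite inUC; exists (outU n); first exact: open_meets.
- by move=> n y; rewrite indicE.
- move=> N; have [S aS] := frechet_urysohn_converges_to hX fuX nx.
  have [Sx _ iS fS] := aS.
  have fSU : finite_set (S `\` \bigcap_(n in `I_N) U n).
    apply/fS/open_nbhs_nbhs; split; last by move=> n _; exact: Unx.
    rewrite -closedC setC_bigcap; apply: closed_bigcup => // n _.
    by rewrite closedC.
  have aSU : converges_to (S `&` \bigcap_(n in `I_N) U n) x.
    apply: converges_to_finite_diff aS _ _ _.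
    + by split=> // n _; exact: Unx.
    + move=> fSI; apply: iS.
      by rewrite -(setUIDK S (\bigcap_(n in `I_N) U n)) finite_setU.
    + by apply: (@sub_finite_set _ _ set0) => // z [[]].
  by exists (Sc_of aSU) => n nN; rewrite indicE mem_set// => z [_]; exact.
have FU n : sval (set_val F) `<=` U n.
  move=> z Fz; apply: contrapT => Uz.
  have nF : nbhs (set_val F) (outU n).
    by apply: open_nbhs_nbhs; split; [exact: open_meets|exists z].
  have [G [hG GU]] := hF n _ (initial_continuous nF).
  by move: hG; rewrite /= indicE memNset ?eqxx// -[~ _]/((~` inU n) G) inUC.
have [y [_ _ iF _]] := Sc_converges_to (set_mem (valP F)).
apply: iF; apply: sub_finite_set (finite_set1 x) => z Fz.
by rewrite Ux => n _; exact: FU.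
Qed.

End pseudocompact_Sc.

Theorem theorem3p9 (R : realType) (X : topologicalType)
    (tychX : tychonoff_space X) (ndX : ~ discrete_space X)
    (fuX : frechet_urysohn_space X)
    (pcS : pseudocompact (set_type (Sc X)) R) :
  [/\ exists D : set X, [/\ dense D, D `<=` isolated [set: X] &
        relatively_countably_compact D],
      forall n : nat, (1 <= n)%N ->
        pseudocompact (prod_topology (fun _ : 'I_n => X)) R &
      forall x : X, Gdelta [set x] -> isolated [set: X] x].
Proof.
have [x nx] : exists x : X, ~ isolated [set: X] x.
  apply: contrapT => allI; apply: ndX.
  apply/funext => x; apply/seteqP; split=> [A xA _ ->|A xA].
    exact: nbhs_singleton.
  have /isolated_setTP ox : isolated [set: X] x.
    by apply: contrapT => nx; apply: allI; exists x.
  by apply: (filterS (P := [set x])) (open_nbhs_nbhs _).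
split.
- exists (~` [set x]); split; first exact: dense_setC1.
    move=> y yx; apply: contrapT => ny; apply: yx.
    exact: (unique_nonisolated tychX fuX pcS ny nx).
  exact: (relatively_countably_compact_setC1 tychX fuX pcS).
- move=> n _; apply: compact_pseudocompact.
  have := @tychonoff 'I_n (fun=> X) (fun=> setT)
    (fun=> compact_setT tychX fuX pcS nx).
  by congr compact; apply/seteqP; split.
- exact: (Gdelta_isolated tychX fuX pcS).
Qed.
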